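(* Let $F$ be an algebraically closed field, let $n\ge 1$ and $s\ge 1$ be integers, and let $I\subseteq F[x_0,\ldots,x_n]$ be the homogeneous ideal of any set of $s$ (distinct) points in the projective space $\mathbb{P}^n$ over $F$. (a) For all integers $m\ge 1$, $$\frac{\alpha(I^{(m)})+n-1}{m+n-1}\le \sqrt[n]{s}.$$ (b) Suppose $n\ge 2$, and let $\varepsilon=\sqrt[n]{s}-\lfloor\sqrt[n]{s}\rfloor$ (so $0\le\varepsilon<1$) be the fractional part of $\sqrt[n]{s}$. If $m\ge 1$ is an integer such that $$\lfloor\sqrt[n]{s}\rfloor-2\ge \frac{2\varepsilon}{n-1}(m-1),$$ then $$\frac{\alpha(I^{(m)})+n-1}{m+n-1}\le \lfloor\sqrt[n]{s}\rfloor.$$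
   Context: For a nonzero homogeneous ideal $J\subseteq F[x_0,\ldots,x_n]$, $\alpha(J)=\min\{\deg f\mid f \text{ is a nonzero homogeneous polynomial in } J\}$. If $I$ is the homogeneous ideal of the finite set of points $\{p_1,\ldots,p_s\}\subset\mathbb{P}^n$, then for an integer $m\ge 1$ the $m$-th symbolic power $I^{(m)}$ is the ideal generated by all homogeneous polynomials $f\in F[x_0,\ldots,x_n]$ that vanish to order at least $m$ at each $p_i$. *)

(* Defs.v *)
From mathcomp Require Import all_boot all_order all_algebra finmap.
From mathcomp Require Import boolp classical_sets reals exp.
From mathcomp Require Import mpoly.

Set Implicit Arguments.
Unset Strict Implicit.
Unset Printing Implicit Defensive.

Import Order.TTheory GRing.Theory Num.Theory.

Local Open Scope classical_set_scope.
Local Open Scope ring_scope.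

(* A point of P^n is a line through the origin of F^(n+1), so that distinct
   points are distinct elements; the homogeneous coordinate vectors of a point
   are the nonzero vectors of the line. *)
Definition proj_space (F : fieldType) (n : nat) :=
  {L : {vspace 'rV[F]_n.+1} | \dim L == 1%N}.

Definition rep (F : fieldType) (n : nat) (p : proj_space F n)
    (v : 'rV[F]_n.+1) : Prop :=
  v \in sval p /\ v != 0.

Section Polynomials.
Variables (F : fieldType) (k : nat).
Implicit Types (f : {mpoly F[k]}) (J S : set {mpoly F[k]}).

(* f(X + v) *)
Definition translate (v : 'rV[F]_k) f : {mpoly F[k]} :=
  f \mPo [tuple 'X_i + (v 0 i)%:MP | i < k].

(* The Taylor expansion of f at v has no term of degree < m; unlike the
   vanishing of iterated derivatives, this is correct in every
   characteristic. *)
Definition vanishes_to_order (m : nat) f (v : 'rV[F]_k) : Prop :=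
  forall mon : 'X_{1..k}, (mdeg mon < m)%N -> (translate v f)@_mon = 0.

Definition homogeneous f : Prop := exists d : nat, f \is d.-homog.

Definition ideal_gen S : set {mpoly F[k]} :=
  [set f | exists (r : nat) (a g : 'I_r -> {mpoly F[k]}),
      (forall i, S (g i)) /\ f = \sum_(i < r) a i * g i].

Definition has_form_of_degree J (d : nat) : Prop :=
  exists f, [/\ J f, f != 0 & f \is d.-homog].

(* The value 0 for an ideal without nonzero homogeneous element is a
   dummy. *)
Definition alpha J : nat :=
  match pselect (exists d, `[< has_form_of_degree J d >]) with
  | left ex => ex_minn ex
  | right _ => 0%N
  end.

Lemma alphaP J : (exists d, has_form_of_degree J d) ->
  has_form_of_degree J (alpha J) /\
  forall d, has_form_of_degree J d -> (alpha J <= d)%N.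
Proof.
move=> [d0 Jd0]; rewrite /alpha; case: pselect => [ex|noex]; last first.
  by case: noex; exists d0; apply/asboolP.
case: ex_minnP => a /asboolP Ja min_a; split=> // d /asboolP; exact: min_a.
Qed.

End Polynomials.

Section SymbolicPowers.
Variables (F : fieldType) (n : nat).
Implicit Types X : {fset proj_space F n}.

Definition ideal_of_points X : set {mpoly F[n.+1]} :=
  ideal_gen [set f | homogeneous f /\
    forall p v, p \in X -> rep p v -> f.@[v 0] = 0].

(* For a homogeneous f, the order of vanishing at a point can be read off at
   any of its homogeneous coordinate vectors. *)
Definition symbolic_power X (m : nat) : set {mpoly F[n.+1]} :=
  ideal_gen [set f | homogeneous f /\
    forall p v, p \in X -> rep p v -> vanishes_to_order m f v].

Lemma vanishes_to_order1 (f : {mpoly F[n.+1]}) (v : 'rV[F]_n.+1) :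
  vanishes_to_order 1 f v <-> f.@[v 0] = 0.
Proof.
have e0 (g : {mpoly F[n.+1]}) : g@_0%MM = g.@[fun=> 0].
  rewrite [g in LHS]mpolyE [g in RHS]mpolyE !raddf_sum /=.
  apply: eq_bigr => mon _; rewrite mcoeffZ mcoeffX mevalZ mevalX.
  congr (_ * _); have [->|mon0] := eqVneq mon 0%MM.
    by rewrite big1 // => i _; rewrite mnm0E expr0.
  have [/forallP mi0|] := boolP [forall i, mon i == 0%N].
    by case/eqP: mon0; apply/mnmP => i; rewrite mnm0E; apply/eqP.
  rewrite negb_forall => /existsP[i mi].
  by rewrite (bigD1 i) //= expr0n (negPf mi) mul0r.
have -> : f.@[v 0] = (translate v f)@_0%MM.
  rewrite e0 /translate comp_mpoly_meval; apply: meval_eq => i.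
  by rewrite tnth_map tnth_ord_tuple mevalD mevalXU mevalC add0r.
split=> [f0|f0 mon]; first by apply: f0; rewrite mdeg0.
by rewrite ltnS leqn0 mdeg_eq0 => /eqP ->.
Qed.

Lemma symbolic_power1 X : symbolic_power X 1 = ideal_of_points X.
Proof.
rewrite /symbolic_power /ideal_of_points; congr ideal_gen.
by apply/seteqP; split=> f [hf f0]; split=> // p v pX pv;
   apply/vanishes_to_order1; exact: f0 pX pv.
Qed.

End SymbolicPowers.

Definition nth_root (R : realType) (n s : nat) : R := s%:R `^ n%:R^-1.

Definition frac_part (R : realType) (x : R) : R := x - (Num.floor x)%:~R.

(* Main.v *)
(* Vanishing to order m at a point of P^n imposes at most C(m+n-1, n) linear
   conditions on the forms of degree t, which form a space of dimension
   C(t+n, n).  Hence alpha <= t as soon as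
   (t+1)...(t+n) > r^n m(m+1)...(m+n-1), where r^n = s.
   For (a), take t = alpha - 1: if alpha+n-1 > r(m+n-1), this inequality holds
   factor by factor because r >= 1.  For (b), take t+n = k(m+n-1)+1 with k the
   integer part of r, and multiply the j-th largest factor on each side by the
   j-th smallest one: the pair on the left has the larger sum, by the assumption
   on m, and the smaller difference, so it has the larger product. *)
Require Import Defs.
From mathcomp Require Import all_boot all_order all_algebra finmap.
From mathcomp Require Import boolp classical_sets reals exp.
From mathcomp Require Import mpoly ring lra.
Import Order.TTheory GRing.Theory Num.Theory.

Set Implicit Arguments.
Unset Strict Implicit.
Unset Printing Implicit Defensive.

Local Open Scope ring_scope.

(** * Linear systems with fewer equations than unknowns *)

Lemma wide_system (F : fieldType) (I J : finType) (phi : I -> J -> F) :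
  (#|J| < #|I|)%N ->
  exists u : I -> F,
    (exists i, u i != 0) /\ forall j, \sum_i u i * phi i j = 0.
Proof.
move=> ltJI.
pose A := \matrix_(i < #|I|, j < #|J|) phi (enum_val i) (enum_val j).
have kA0 : kermx A != 0.
  rewrite kermx_eq0 /row_free neq_ltn; apply/orP; left.
  exact: leq_ltn_trans (rank_leq_col A) ltJI.
pose u := nz_row (kermx A).
have /rV0Pn[i ui0] : u != 0 by rewrite nz_row_eq0.
have uA : u *m A = 0 by apply/sub_kermxP; exact: nz_row_sub.
exists (fun i => u 0 (enum_rank i)); split=> [|j].
  by exists (enum_val i); rewrite enum_valK.
have := congr1 (fun B : 'rV_ _ => B 0 (enum_rank j)) uA.
rewrite !mxE => {2}<-.
rewrite (reindex (@enum_val I predT)) /=; last first.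
  by apply: onW_bij; exact: enum_val_bij.
by apply: eq_bigr => k _; rewrite enum_valK mxE !enum_rankK.
Qed.

(** * Substitution in polynomials and order of vanishing at the origin *)

Section MPoly.
Variables (F : fieldType) (k : nat).
Implicit Types (f g : {mpoly F[k]}) (lq lr : k.-tuple {mpoly F[k]}).

Lemma comp_mpolyA f lq lr :
  (f \mPo lq) \mPo lr = f \mPo [tuple tnth lq i \mPo lr | i < k].
Proof.
rewrite (comp_mpolyE f) [RHS]comp_mpolyE raddf_sum /=.
apply: eq_bigr => mon _; rewrite comp_mpolyZ rmorph_prod /=; congr (_ *: _).
by apply: eq_bigr => i _; rewrite rmorphXn /= tnth_mktuple.
Qed.

Lemma comp_mpoly_homog d f lq :
  f \is d.-homog -> (forall i, tnth lq i \is 1.-homog) ->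
  f \mPo lq \is d.-homog.
Proof.
move=> homf homlq; rewrite comp_mpolyE big_seq.
apply: rpred_sum => mon /(dhomog_mf homf) /= <-; apply: rpredZ.
rewrite mdegE; elim/big_ind2: _ => [|d1 p1 d2 p2 h1 h2|i _].
- exact: (@dhomog1 _ F mdeg).
- exact: (@dhomogM _ F mdeg).
by have := dhomogMn (mon i) (homlq i); rewrite mul1n.
Qed.

(** [vanishes_to_order m f v] is [order_ge m (translate v f)]. *)
Definition order_ge (m : nat) f :=
  forall mon : 'X_{1..k}, (mdeg mon < m)%N -> f@_mon = 0.

Lemma order_geW m m' f : (m' <= m)%N -> order_ge m f -> order_ge m' f.
Proof. by move=> lem fm mon /leq_trans/(_ lem); exact: fm. Qed.

Lemma order_geM m m' f g :
  order_ge m f -> order_ge m' g -> order_ge (m + m') (f * g).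
Proof.
move=> fm gm mon ltmon; rewrite mcoeffM big1 // => -[a b] /eqP/= defmon.
have [/fm-> //|lema] := ltnP (mdeg a) m; first by rewrite mul0r.
rewrite gm ?mulr0 // -(ltn_add2l m); apply: leq_ltn_trans ltmon.
by rewrite [leqRHS](congr1 mdeg defmon) mdegD leq_add2r.
Qed.

Lemma order_geXn m f e : order_ge m f -> order_ge (m * e) (f ^+ e).
Proof.
move=> fm; elim: e => [|e IHe]; first by rewrite muln0.
by rewrite exprS mulnS; apply: order_geM.
Qed.

(** Orders add up in products, so a monomial of weight [\sum_i e i * mon i] is sent to a polynomial
    of at least that order. *)
Lemma comp_order_ge m f lq (e : 'I_k -> nat) :
    (forall i, order_ge (e i) (tnth lq i)) ->
    (forall mon : 'X_{1..k}, (\sum_i e i * mon i < m)%N -> f@_mon = 0) ->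
  order_ge m (f \mPo lq).
Proof.
move=> elq fm mon ltmon; rewrite comp_mpolyE raddf_sum /= big_seq big1 //.
move=> mon' f_mon'; rewrite mcoeffZ.
have [/fm->|lem] := ltnP (\sum_i e i * mon' i) m; first by rewrite mul0r.
suff prod_ge : order_ge (\sum_i e i * mon' i) (\prod_i tnth lq i ^+ mon' i).
  by rewrite (order_geW lem prod_ge) ?mulr0.
elim/big_ind2: _ => // [d1 p1 d2 p2|i _]; first exact: order_geM.
exact: order_geXn.
Qed.

End MPoly.

(** * Linear coordinates in which a point is an axis *)

Section Coordinates.
Variables (F : fieldType) (n : nat) (v : 'rV[F]_n.+1) (i : 'I_n.+1).

(* As maps of the affine space, [to_axis] sends the [i]-th unit vector to [v] and
   fixes the others, and [of_axis] is its inverse when [v 0 i != 0]. *)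
Definition to_axis : n.+1.-tuple {mpoly F[n.+1]} :=
  [tuple if j == i then v 0 i *: 'X_i else 'X_j + v 0 j *: 'X_i | j < n.+1].

Definition of_axis : n.+1.-tuple {mpoly F[n.+1]} :=
  [tuple if j == i then (v 0 i)^-1 *: 'X_i
         else 'X_j - (v 0 j / v 0 i) *: 'X_i | j < n.+1].

Lemma to_axis_homog d (f : {mpoly F[n.+1]}) :
  f \is d.-homog -> f \mPo to_axis \is d.-homog.
Proof.
move=> homf; apply: comp_mpoly_homog => // j; rewrite tnth_mktuple.
have homX l : ('X_l : {mpoly F[n.+1]}) \is 1.-homog by rewrite dhomogX /= mdeg1.
by case: eqP => _; rewrite ?rpredD ?rpredZ.
Qed.

Lemma to_axisK (f : {mpoly F[n.+1]}) :
  v 0 i != 0 -> (f \mPo to_axis) \mPo of_axis = f.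
Proof.
move=> vi0; rewrite comp_mpolyA -[RHS]comp_mpoly_id.
congr (_ \mPo _); apply: eq_from_tnth => j; rewrite !tnth_mktuple.
have XE l : 'X_l \mPo of_axis = tnth of_axis l.
  by rewrite comp_mpolyXU (tnth_nth 0).
have [->|ji] := eqVneq j i.
  by rewrite comp_mpolyZ XE tnth_mktuple eqxx scalerA divff ?scale1r.
rewrite comp_mpolyD comp_mpolyZ !XE !tnth_mktuple eqxx (negPf ji) scalerA.
by rewrite subrK.
Qed.

(* In coordinates where the point is the [i]-th axis, the order of vanishing of a
   form at any nonzero vector of the line is bounded below by the least total
   exponent of the other variables; so only monomials in n variables of degree
   < m have to be excluded, and all representatives are handled at once. *)
Lemma vanishes_along_axis (d m : nat) (c : F) (f : {mpoly F[n.+1]}) :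
    v 0 i != 0 -> f \is d.-homog ->
    (forall mon : 'X_{1..n.+1}, mdeg mon = d ->
      (\sum_(j < n) mon (lift i j) < m)%N -> (f \mPo to_axis)@_mon = 0) ->
  vanishes_to_order m f (c *: v).
Proof.
move=> vi0 homf fm; rewrite /vanishes_to_order -[f](to_axisK _ vi0) /translate.
rewrite comp_mpolyA.
(* Weight 0 for the [i]-th variable, weight 1 for the others: after translation by [c *: v], the
   constant terms of [tnth of_axis j] cancel when [j != i]. *)
apply: (@comp_order_ge _ _ _ _ _ (fun j => (j != i : nat))) => [j|mon].
  rewrite tnth_mktuple; have [//|ji] := eqVneq j i.
  set tr := [tuple _ | _ < _].
  have XE l : 'X_l \mPo tr = 'X_l + (c * v 0 l)%:MP.
    by rewrite comp_mpolyXU -tnth_nth tnth_mktuple mxE.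
  have -> : tnth of_axis j \mPo tr = 'X_j - (v 0 j / v 0 i) *: 'X_i.
    rewrite tnth_mktuple (negPf ji) comp_mpolyB comp_mpolyZ !XE scalerDr.
    rewrite -(mul_mpolyC _ (c * _)%:MP) -rmorphM /= mulrCA divfK //.
    by rewrite opprD addrACA subrr addr0.
  move=> mon; rewrite ltnS leqn0 mdeg_eq0 => /eqP->.
  by rewrite mcoeffB mcoeffZ !mcoeffX !mnm1_eq0 mulr0 subrr.
rewrite (bigD1_ord i) //= eqxx mul0n add0n => ltm.
have [degmon|degmon] := eqVneq (mdeg mon) d; last first.
  exact: dhomog_nemf_coeff (to_axis_homog homf) degmon.
apply: fm => //; apply: leq_ltn_trans ltm; apply: leq_sum => j _.
by rewrite eq_sym neq_lift mul1n.
Qed.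

End Coordinates.

(** * Counting coefficients of forms against vanishing conditions *)

Lemma proj_space_axis (F : fieldType) (n : nat) (p : proj_space F n) :
  exists vi : 'rV[F]_n.+1 * 'I_n.+1, vi.1 0 vi.2 != 0 /\
    forall w, rep p w -> exists c, w = c *: vi.1.
Proof.
case: p => L /= dimL; pose v := vpick L.
have v0 : v != 0 by rewrite vpick0 -dimv_eq0 (eqP dimL).
have /eqP defL : <[v]>%VS == L.
  by rewrite eqEdim -memvE memv_pick dim_vline v0 (eqP dimL).
have /rV0Pn[i vi0] := v0; exists (v, i); split=> // w [/=].
by rewrite -{1}defL => /vlineP.
Qed.

(** The unknowns are the coefficients of a form of degree [t]; each point contributes the equations
    of [vanishes_along_axis], one per monomial of degree < [m] in [n] variables. *)
Lemma form_in_symbolic_power (F : fieldType) (n t m : nat)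
    (X : {fset proj_space F n}) : (0 < m)%N ->
    (#|` X|%fset * 'C(m + n - 1, n) < 'C(t + n, n))%N ->
  has_form_of_degree (symbolic_power X m) t.
Proof.
(* From here on the order is [m.+1], so [Q] lists the exponents of total degree at most [m]. *)
case: m => // m _; rewrite addSn subn1 /= addnC [(t + n)%N]addnC => ltC.
have /choice[axis axisP] := @proj_space_axis F n.
pose I := {x : n.+1.-tuple 'I_t.+1 |
  x \in finset (fun x : n.+1.-tuple 'I_t.+1 => (\sum_(i <- x) i)%N == t)}.
pose Q := {q : n.-tuple 'I_m.+1 |
  q \in finset (fun q : n.-tuple 'I_m.+1 => (\sum_(i <- q) i <= m)%N)}.
pose monI (x : I) : 'X_{1..n.+1} :=
  [multinom (tnth (val x) i : nat) | i < n.+1].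
(* The exponent of the [i]-th variable completes the degree to [t]. If [q] already exceeds [t], the
   truncated subtraction gives 0 and the condition holds trivially. *)
pose monQ (i : 'I_n.+1) (q : Q) : 'X_{1..n.+1} :=
  [multinom if unlift i j is Some k then tnth (val q) k : nat
            else (t - \sum_(k <- val q) k)%N | j < n.+1].
have degI x : mdeg (monI x) = t.
  have := valP x; rewrite inE big_tuple => /eqP sumx.
  by rewrite mdegE -[RHS]sumx; apply: eq_bigr => i _; rewrite mnmE.
have monI_inj : injective monI.
  move=> x y eqxy; apply/val_inj/eq_from_tnth => i; apply: val_inj.
  by have := congr1 (fun mon : 'X_{1..n.+1} => mon i) eqxy; rewrite !mnmE.
pose cond (x : I) (pq : X * Q) : F :=
  ('X_[monI x] \mPo to_axis (axis (val pq.1)).1 (axis (val pq.1)).2)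
    @_(monQ (axis (val pq.1)).2 pq.2).
have [|u [[x0 ux0] uC]] := @wide_system F _ _ cond.
  rewrite card_prod !card_sig -cardfE.
  rewrite [X in (_ * X < _)%N](_ : _ = 'C(n + m, n)); last first.
    by rewrite -card_partial_ord_partitions; apply: eq_card.
  rewrite [X in (_ < X)%N](_ : _ = 'C(n + t, n)) //.
  by rewrite -card_ord_partitions; apply: eq_card.
pose f := \sum_(x : I) u x *: 'X_[monI x] : {mpoly F[n.+1]}.
have homf : f \is t.-homog.
  by apply: rpred_sum => x _; apply: rpredZ; rewrite dhomogX /= degI.
have f0 : f != 0.
  apply: contraNneq ux0 => f0; have := mcoeff0 F (monI x0).
  rewrite -f0 raddf_sum (bigD1 x0) //= mcoeffZ mcoeffX eqxx mulr1.
  rewrite big1 ?addr0 => [->//|x xx0].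
  by rewrite mcoeffZ mcoeffX (inj_eq monI_inj) (negPf xx0) mulr0.
exists f; split=> //; exists 1%N, (fun=> 1), (fun=> f).
split; last by rewrite big_ord1 mul1r.
move=> _; split; first by exists t.
move=> p w pX /(proj2 (axisP p)) [c ->].
apply: vanishes_along_axis (proj1 (axisP p)) homf _ => mon degmon ltm.
set i := (axis p).2 in ltm *.
have lemon k : (mon (lift i k) < m.+1)%N.
  by apply: leq_ltn_trans ltm; rewrite (bigD1 k) //= leq_addr.
pose q0 := [tuple inord (mon (lift i k)) : 'I_m.+1 | k < n].
have sumq0 : (\sum_(k <- q0) k = \sum_(k < n) mon (lift i k))%N.
  rewrite big_tuple; apply: eq_bigr => k _.
  by rewrite tnth_mktuple inordK.
have q0P : q0 \in
    finset (fun q : n.-tuple 'I_m.+1 => (\sum_(i <- q) i <= m)%N).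
  by rewrite inE sumq0.
have -> : mon = monQ i (Sub q0 q0P).
  apply/mnmP => j; rewrite mnmE; case: unliftP => [k ->|->] /=.
    by rewrite tnth_mktuple inordK.
  by rewrite sumq0 -degmon mdegE (bigD1_ord i) //= addnK.
have := uC ([` pX]%fset, Sub q0 q0P) => <-.
rewrite (raddf_sum (comp_mpoly _)) raddf_sum /=; apply: eq_bigr => x _.
by rewrite comp_mpolyZ mcoeffZ.
Qed.

(** * From binomial coefficients to products of real numbers *)

Lemma alpha_le (F : fieldType) (n : nat) J (d : nat) :
  @has_form_of_degree F n J d -> (alpha J <= d)%N.
Proof. by move=> Jd; have [_] := alphaP (ex_intro _ d Jd); apply. Qed.

Lemma natr_ffact (R : realFieldType) (N n : nat) : (n <= N)%N ->
  (N ^_ n)%:R = \prod_(j < n) (N%:R - j%:R) :> R.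
Proof.
move=> lenN; rewrite ffact_prod natr_prod; apply: eq_bigr => j _.
by rewrite natrB // (leq_trans (ltnW (ltn_ord j))).
Qed.

(** Multiplication by [n!] turns the binomial coefficients into falling factorials, which can be
    compared factor by factor. *)
Lemma alpha_le_of_prod (R : realFieldType) (F : fieldType) (n m t : nat)
    (X : {fset proj_space F n}) : (0 < m)%N ->
    #|` X|%fset%:R * \prod_(j < n) (m%:R + n%:R - 1 - j%:R)
      < \prod_(j < n) (t%:R + n%:R - j%:R) :> R ->
  (alpha (symbolic_power X m) <= t)%N.
Proof.
case: m => // m _ ltprod; apply/alpha_le/form_in_symbolic_power => //.
rewrite -(ltn_pmul2r (fact_gt0 n)) -mulnA !bin_ffact -(ltr_nat R) natrM.
rewrite !natr_ffact ?leq_addl //; last by rewrite addSn subn1 leq_addl.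
rewrite addSn subn1 /= !natrD; congr (_ < _): ltprod.
congr (_ * _). apply: eq_bigr => j _; congr (_ - _).
by rewrite -natr1; ring.
Qed.

Lemma nth_root_ge1 (R : realType) (n s : nat) :
  (0 < s)%N -> 1 <= nth_root R n s.
Proof.
move=> s0; have <- : 1 `^ n%:R^-1 = 1 :> R by rewrite powR1.
rewrite ge0_ler_powR ?nnegrE ?invr_ge0 //.
by rewrite ler1n.
Qed.

Lemma nth_rootK (R : realType) (n s : nat) :
  (0 < n)%N -> nth_root R n s ^+ n = s%:R.
Proof.
move=> n0; rewrite -powR_mulrn ?powR_ge0 // /nth_root -powRrM.
by rewrite mulVf ?pnatr_eq0 -?lt0n // powRr1.
Qed.

(** Four times a product is the square of the sum minus the square of the difference. *)
Lemma ltr_mul_of_sum_diff (R : realFieldType) (x y z w : R) :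
  0 <= x + y -> x + y < z + w -> (z - w) ^+ 2 <= (x - y) ^+ 2 ->
  x * y < z * w.
Proof. by move=> xy0 ltsum lediff; nra. Qed.

(** The square of each product is the product of its pairs [j], [rev_ord j]; squaring also covers a
    middle factor paired with itself. *)
Lemma ltr_prod_rev (R : realDomainType) (n : nat) (A B : 'I_n -> R) :
    (0 < n)%N -> (forall j, 0 <= A j) -> (forall j, 0 <= B j) ->
    (forall j, A j * A (rev_ord j) < B j * B (rev_ord j)) ->
  \prod_j A j < \prod_j B j.
Proof.
move=> n0 A0 B0 ltAB.
rewrite -(ltr_pXn2r (isT : (0 < 2)%N)) ?nnegrE ?prodr_ge0 // !expr2.
rewrite [X in _ * X < _](reindex_inj rev_ord_inj).
rewrite [X in _ < _ * X](reindex_inj rev_ord_inj) -!big_split /=.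
apply: ltr_prod => [|j _]; last by rewrite mulr_ge0 ?ltAB.
by apply/hasP; exists (Ordinal n0); rewrite ?mem_index_enum.
Qed.

Theorem theorem1 (R : realType) (F : closedFieldType) (n s : nat)
    (hn : (1 <= n)%N) (hs : (1 <= s)%N)
    (X : {fset proj_space F n}) (hX : #|` X|%fset = s) :
  (forall m : nat, (1 <= m)%N ->
     ((alpha (symbolic_power X m))%:R + n%:R - 1) / (m%:R + n%:R - 1)
       <= nth_root R n s)
  /\
  ((2 <= n)%N ->
   forall m : nat, (1 <= m)%N ->
     (Num.floor (nth_root R n s))%:~R - 2
       >= 2 * frac_part (nth_root R n s) / (n%:R - 1) * (m%:R - 1) ->
     ((alpha (symbolic_power X m))%:R + n%:R - 1) / (m%:R + n%:R - 1)
       <= (Num.floor (nth_root R n s))%:~R :> R).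
Proof.
have r1 := nth_root_ge1 R n hs; have rn := nth_rootK R s hn.
set r := nth_root R n s in r1 rn *.
have n1 : 1 <= n%:R :> R by rewrite ler1n.
have jn (j : 'I_n) : j%:R + 1 <= n%:R :> R by rewrite natr1 ler_nat.
have j0 (j : 'I_n) : 0 <= j%:R :> R by [].
have alpha_bound (m t : nat) : (0 < m)%N ->
    \prod_(j < n) (r * (m%:R + n%:R - 1 - j%:R))
      < \prod_(j < n) (t%:R + n%:R - j%:R) ->
    (alpha (symbolic_power X m) <= t)%N.
  move=> m0 ltprod; apply: (@alpha_le_of_prod R) => //; rewrite hX -rn.
  by rewrite big_split /= prodr_const card_ord in ltprod.
split=> [m m0|n2 m m0].
  have m1 : 1 <= m%:R :> R by rewrite ler1n.
  rewrite ler_pdivrMr; last by lra.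
  rewrite leNgt; apply/negP => lta.
  (* If [alpha] were 0, [lta] would give [r * (m + n - 1) < n - 1], against [r >= 1]. *)
  have a0 : (0 < alpha (symbolic_power X m))%N by rewrite -(ltr_nat R); nra.
  rewrite -(prednK a0) in lta; set t := (alpha _).-1 in lta.
  suff : (alpha (symbolic_power X m) <= t)%N by rewrite leqNgt ltn_predL a0.
  apply: alpha_bound => //; apply: ltr_prod => [|j _].
    by apply/hasP; exists (Ordinal hn); rewrite ?mem_index_enum.
  (* Now [lta] reads [r * (m + n - 1) < t + n]; subtract [r * j >= j]. *)
  have := jn j; have := j0 j; rewrite -natr1 in lta => jge0 jlt.
  by apply/andP; split; nra.
have m1 : 1 <= m%:R :> R by rewrite ler1n.
have n2R : 2 <= n%:R :> R by rewrite ler_nat.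
rewrite /frac_part; have /andP[ler ltr] := floor_itv r.
have : 0 <= Num.floor r by rewrite floor_ge0; lra.
rewrite rmorphD /= in ltr; case: (Num.floor r) ler ltr => // k ler ltr _.
rewrite -[_%:~R]/(k%:R) in ler ltr * => hk.
have {}hk : 2 * (r - k%:R) * (m%:R - 1) <= (k%:R - 2) * (n%:R - 1).
  by rewrite mulrAC ler_pdivrMr in hk; lra.
have k0 : (0 < k)%N by rewrite -(ltr_nat R); lra.
have k1 : 1 <= k%:R :> R by rewrite ler1n.
(* With this [t], [alpha <= t] is exactly the claim. The subtraction is not truncated, since
   [k >= 1] and [m >= 1]. *)
pose t := (k * (m + n - 1) + 1 - n)%N.
have tE : t%:R + n%:R = k%:R * (m%:R + n%:R - 1) + 1 :> R.
  rewrite -natrD subnK; last first.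
    apply: (@leq_trans (m + n - 1 + 1)); last by rewrite leq_add2r leq_pmull.
    by rewrite subnK ?leq_addl // addn_gt0 m0.
  by rewrite natrD natrM natrB ?natrD // addn_gt0 m0.
rewrite ler_pdivrMr; last by lra.
suff : (alpha (symbolic_power X m) <= t)%N by rewrite -(ler_nat R); lra.
apply: alpha_bound => //; apply: ltr_prod_rev => // j.
- by rewrite mulr_ge0 //; have := jn j; lra.
- have := jn j; rewrite tE.
  have : 1 * (m%:R + n%:R - 1) <= k%:R * (m%:R + n%:R - 1) :> R.
    by rewrite ler_wpM2r //; lra.
  by lra.
have revE : (rev_ord j)%:R = n%:R - 1 - j%:R :> R.
  by rewrite /= natrB // -natr1; lra.
have := jn j; have := j0 j; rewrite tE revE => jge0 jlt.
apply: ltr_mul_of_sum_diff.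
- by apply: addr_ge0; apply: mulr_ge0; lra.
(* By [hk], the two sums differ by at least this product, which is positive because [r < k + 1]. *)
- have : 0 < (k%:R + 1 - r) * (n%:R + 1) by rewrite mulr_gt0 //; lra.
  by lra.
(* The differences are [y = n - 1 - 2j] for the factors with [t] and [r * y] for those with [m], and
   [r >= 1]. *)
set z := (X in X <= _); set y := n%:R - 1 - j%:R - j%:R : R.
have -> : z = y ^+ 2 by rewrite /z /y; ring.
rewrite -mulrBr [X in r * X](_ : _ = y) /y; last by ring.
rewrite exprMn.
by rewrite ler_peMl ?sqr_ge0 // expr_ge1 //; lra.
Qed.
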